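(* Let $\&$ be a left continuous t-norm on the unit interval and let $\mathcal{Q}=([0,1],\&)$. Then irreducible ideals coincide with forward Cauchy ideals; that is, for every $\mathcal{Q}$-ordered set $A$, a fuzzy lower set of $A$ is an irreducible ideal if and only if it is a forward Cauchy ideal.
   Context: A left continuous t-norm is a binary operation $\&$ on $[0,1]$ that is commutative, associative, monotone, has unit $1$, and is left continuous in each variable; equivalently, $\mathcal{Q}=([0,1],\&)$ is an integral commutative quantale, i.e. $\&$ distributes over arbitrary joins. Its implication $\to$ is defined by $p\&q\le r\iff q\le p\to r$. Below $Q=[0,1]$. A $\mathcal{Q}$-ordered set is a set $A$ with a map $A(-,-):A\times A\to Q$ such that $A(x,x)=1$ and $A(y,z)\&A(x,y)\le A(x,z)$ for all $x,y,z\in A$. A fuzzy lower set of $A$ is a map $\phi:A\to Q$ with $\phi(y)\&A(x,y)\le\phi(x)$ for all $x,y$. Joins of maps $A\to Q$ are pointwise. For fuzzy lower sets, $\mathrm{sub}_A(\phi_1,\phi_2)=\bigwedge_{x\in A}(\phi_1(x)\to\phi_2(x))$. A map $\lambda:A\to Q$ is inhabited if $\bigvee_{a\in A}\lambda(a)=1$. A net $\{x_i\}$ in $A$ is forward Cauchy if $\bigvee_i\bigwedge_{i\le j\le k}A(x_j,x_k)=1$. A fuzzy lower set $\phi$ of $A$ is a forward Cauchy ideal if $\phi=\bigvee_i\bigwedge_{j\ge i}A(-,x_j)$ for some forward Cauchy net $\{x_i\}$ in $A$. A fuzzy lower set $\phi$ is an irreducible ideal if it is inhabited and $\mathrm{sub}_A(\phi,\phi_1\vee\phi_2)=\mathrm{sub}_A(\phi,\phi_1)\vee\mathrm{sub}_A(\phi,\phi_2)$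 for all fuzzy lower sets $\phi_1,\phi_2$ of $A$. *)

(* Defs.v *)
From HB Require Import structures.
From mathcomp Require Import all_boot all_order all_algebra.
From mathcomp Require Import all_classical all_reals all_analysis.

Set Implicit Arguments.
Unset Strict Implicit.
Unset Printing Implicit Defensive.

Import Order.TTheory GRing.Theory Num.Theory.
Import numFieldNormedType.Exports.

Local Open Scope classical_set_scope.
Local Open Scope ring_scope.

Section UnitInterval.
Variable R : realType.
Local Notation Q := {i01 R}.
Implicit Types (S : set Q) (p q r : Q).

(* The defaults are the values of the empty join and meet in [0, 1]. *)
Definition joinQ S : Q := supremum 0%:i01 S.
Definition meetQ S : Q := infimum 1%:i01 S.

Lemma leQE p q : (p <= q) = (p%:num <= q%:num).
Proof. by []. Qed.

Lemma ge0Q p : 0%:i01 <= p.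
Proof. by rewrite leQE /=. Qed.

Lemma le1Q p : p <= 1%:i01.
Proof. by rewrite leQE /=. Qed.

Lemma supremumsQ_neq0 S : supremums S !=set0.
Proof.
have [->|/set0P [s Ss]] := eqVneq S set0.
  by exists 0%:i01; split => [? []|q _]; exact: ge0Q.
set E : set R := (fun q : Q => q%:num) @` S.
have Esup : has_sup E.
  by split; [exists s%:num, s|exists 1 => _ [q _ <-]].
have E0 : 0 <= sup E.
  by apply: le_trans (ge0 s) _; apply: ub_le_sup; [exact: Esup.2|exists s].
have E1 : sup E <= 1 by apply: ge_sup; [exact: Esup.1|move=> _ [q _ <-]].
exists (Itv01 E0 E1); split => [q Sq|q Sq]; rewrite leQE /=.
  by apply: ub_le_sup; [exact: Esup.2|exists q].
by apply: ge_sup; [exact: Esup.1|move=> _ [t St <-]; rewrite -leQE; exact: Sq].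
Qed.

Lemma joinQ_ub S q : S q -> q <= joinQ S.
Proof. by move=> Sq; apply: ge_supremum_Nmem => //; exact: supremumsQ_neq0. Qed.

Lemma joinQ_le S q : (forall p, S p -> p <= q) -> joinQ S <= q.
Proof.
move=> Sq; rewrite /joinQ /supremum; case: ifPn => [_|_]; first exact: ge0Q.
by have [_ lubp] := xgetPex 0%:i01 (supremumsQ_neq0 S); exact: lubp.
Qed.

Lemma meetQE S : meetQ S = joinQ (lbound S).
Proof.
have lb_join : infimums S (joinQ (lbound S)).
  split=> [q Sq|q Sq]; last exact: joinQ_ub.
  by apply: joinQ_le => p; apply.
rewrite /meetQ /infimum; case: ifPn => [/eqP ->|_].
  apply: le_anti; rewrite le1Q andbT.
  by apply: joinQ_ub => q [].
by apply: xget_subset1 => //; exact: is_subset1_infimums.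
Qed.

Lemma meetQ_lb S q : S q -> meetQ S <= q.
Proof. by move=> Sq; rewrite meetQE; apply: joinQ_le => p; apply. Qed.

Lemma meetQ_ge S q : (forall p, S p -> q <= p) -> q <= meetQ S.
Proof. by move=> Sq; rewrite meetQE; apply: joinQ_ub. Qed.

(* At x = 0 the punctured left neighbourhood is empty and the condition is void. *)
Definition left_continuous (f : Q -> Q) := forall x : Q,
  (f y)%:num @[y --> within [set y : Q | y < x]
    (nbhs (x : initial_topology (fun q : Q => q%:num)))] --> (f x)%:num.

Record left_continuous_tnorm (T : Q -> Q -> Q) : Prop := LeftContinuousTNorm {
  tnormC : commutative T ;
  tnormA : associative T ;
  tnorm_le : forall p p' q q', p <= p' -> q <= q' -> T p q <= T p' q' ;
  tnorm1q : left_id 1%:i01 T ;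
  tnormq1 : right_id 1%:i01 T ;
  tnorm_lcontl : forall q, left_continuous (T ^~ q) ;
  tnorm_lcontr : forall p, left_continuous (T p)
}.

Definition residuum (T : Q -> Q -> Q) p r : Q := joinQ [set q | T p q <= r].

Lemma residuumP (T : Q -> Q -> Q) : left_continuous_tnorm T ->
  forall p q r, T p q <= r <-> q <= residuum T p r.
Proof.
move=> hT p q r; split=> [Tpq|]; first exact: joinQ_ub.
set S := [set q | T p q <= r]; rewrite /residuum -/S; set s := joinQ S => qs.
suff Tps : T p s <= r.
  by apply: le_trans Tps; apply: tnorm_le.
have S0 : S 0%:i01.
  apply: le_trans (tnorm_le hT (le1Q p) (lexx _)) _.
  by rewrite tnorm1q// ge0Q.
rewrite leNgt; apply/negP => rTps.
have : \forall y \near within [set y : Q | y < s]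
    (nbhs (s : initial_topology (fun q : Q => q%:num))), r%:num < (T p y)%:num.
  have rTpsR : r%:num < (T p s)%:num by [].
  exact: (tnorm_lcontr hT (p := p) (x := s) (lt_nbhsr rTpsR)).
case=> _ [[B oB <-] Bs] /= sub_B.
have /nbhs_ballP[e /= e0 sB] : nbhs s%:num B by apply: open_nbhs_nbhs.
have [t St st] : exists2 t, S t & s%:num - e < t%:num.
  apply: contrapT => /forall2NP St.
  have lt_t t : S t -> t%:num <= s%:num - e.
    by move=> tS; case: (St t) => // /negP; rewrite -leNgt.
  have se0 : 0 <= s%:num - e by exact: lt_t S0.
  have se1 : s%:num - e <= 1.
    by apply: le_trans (_ : s%:num <= 1) => //; rewrite gerBl ltW.
  have : s <= Itv01 se0 se1 by apply: joinQ_le => t /lt_t.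
  by rewrite leQE /= lerDl oppr_ge0 leNgt e0.
have ts : t < s.
  rewrite lt_neqAle joinQ_ub// andbT; apply/eqP => ts.
  by move: rTps; rewrite -ts ltNge => /negP; apply.
have : r < T p t.
  apply: sub_B => //; apply: sB; rewrite /ball /= ger0_norm.
    by rewrite ltrBlDr -ltrBlDl.
  by rewrite subr_ge0; exact: ltW.
by rewrite ltNge => /negP; apply.
Qed.

End UnitInterval.

Section FuzzyOrder.
Variables (R : realType) (T : {i01 R} -> {i01 R} -> {i01 R}).
Local Notation Q := {i01 R}.
Variables (A : Type) (dA : A -> A -> Q).

Record Q_order : Prop := QOrder {
  Q_order_refl : forall x, dA x x = 1%:i01 ;
  Q_order_trans : forall x y z, T (dA y z) (dA x y) <= dA x z
}.

Definition fuzzy_lower_set (phi : A -> Q) :=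
  forall x y, T (phi y) (dA x y) <= phi x.

Definition subA (phi1 phi2 : A -> Q) : Q :=
  meetQ (range (fun x => residuum T (phi1 x) (phi2 x))).

Definition fuzzy_inhabited (lambda : A -> Q) := joinQ (range lambda) = 1%:i01.

Record directed (I : Type) (le : I -> I -> Prop) : Prop := Directed {
  directed_inh : inhabited I ;
  directed_refl : forall i, le i i ;
  directed_trans : forall i j k, le i j -> le j k -> le i k ;
  directed_ub : forall i j, exists k, le i k /\ le j k
}.

Definition forward_cauchy (I : Type) (le : I -> I -> Prop) (x : I -> A) :=
  joinQ (range (fun i => meetQ
    [set dA (x jk.1) (x jk.2) | jk in [set jk | le i jk.1 /\ le jk.1 jk.2]]))
  = 1%:i01.

Definition forward_cauchy_ideal (phi : A -> Q) :=
  fuzzy_lower_set phi /\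
  exists (I : Type) (le : I -> I -> Prop) (x : I -> A),
    [/\ directed le, forward_cauchy le x &
      forall a, phi a =
        joinQ (range (fun i => meetQ [set dA a (x j) | j in [set j | le i j]]))].

Definition irreducible_ideal (phi : A -> Q) :=
  [/\ fuzzy_lower_set phi, fuzzy_inhabited phi &
    forall phi1 phi2, fuzzy_lower_set phi1 -> fuzzy_lower_set phi2 ->
      subA phi (phi1 \max phi2) = Order.max (subA phi phi1) (subA phi phi2)].

End FuzzyOrder.

(* Main.v *)
Require Import Defs.
From mathcomp Require Import all_boot all_order all_algebra.
From mathcomp Require Import all_classical all_reals all_analysis.

(** Both implications rest on the fact that the unit interval is a dense chain
in which every [T p] preserves joins, i.e. has [residuum T p] as right adjoint.

A forward Cauchy ideal is irreducible.  Let [phi] be generated by the forward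
Cauchy net [x], let [s] be the degree to which [phi] lies in [phi1 \max phi2],
and let [c_i] be the meet of the [dA (x j) (x k)] over [i <= j <= k].  Since
[c_i <= phi (x j)] for [j >= i], eventually [T c_i s] is below
[phi1 (x j) \max phi2 (x j)].  As [{i01 R}] is a chain and the index set is
directed, one of the two lower sets is above [T c_i s] at cofinally many [x j],
and a lower set that is cofinally above a value contains [phi] to at least that
degree ([cofinal_le_subA]).  The join of [T c_i s] over [i] is [s] because the
join of the [c_i] is [1].

An irreducible ideal is forward Cauchy.  In a chain, [subA T phi psi < 1] just
says that [phi] is not below [psi] pointwise, so irreducibility turns two
failures of containment into one at a common point.  Applied to the lower sets
[fun x => residuum T (dA a x) p] and to constants, this gives
([irreducible_common_ub]): whenever [p < phi a], [q < phi b] and [r < 1], some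
[x] has [r < phi x], [p < dA a x] and [q < dA b x].  This makes the formal balls
[(x, r)] with [r < phi x] directed for the order
[(x, r) <= (y, s) := r <= T s (dA x y)].  The strict inequality [r < phi x]
leaves the room needed to absorb the loss caused by [T].  The projection
[(x, r) |-> x] is the required net: above [(x, r)] all its distances are at
least [r], and [r] can be taken arbitrarily close to [1]. *)

Set Implicit Arguments.
Unset Strict Implicit.
Unset Printing Implicit Defensive.

Import Order.TTheory GRing.Theory Num.Theory.

Local Open Scope classical_set_scope.
Local Open Scope ring_scope.

(** * The unit interval and its left continuous t-norms *)

Section UnitInterval.
Variable R : realType.
Implicit Types p q r t : {i01 R}.

Lemma i01_dense p q : p < q -> exists2 r, p < r & r < q.
Proof.
move=> pq; have pqR : p%:num < q%:num by [].
have m0 : 0 <= (p%:num + q%:num) / 2 by rewrite divr_ge0// addr_ge0.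
have m1 : (p%:num + q%:num) / 2 <= 1.
  by rewrite ler_pdivrMr// mul1r lerD.
have [pm mq] := midf_lt pqR.
by exists (Itv01 m0 m1).
Qed.

Lemma le_of_lt_le p q : (forall r, r < q -> r <= p) -> q <= p.
Proof.
move=> qp; rewrite leNgt; apply/negP => /i01_dense[r pr /qp].
by rewrite leNgt pr.
Qed.

Lemma lt_joinQ (S : set {i01 R}) p : p < joinQ S -> exists2 q, S q & p < q.
Proof.
move=> pS; apply: contrapT => /forall2NP noq.
have : joinQ S <= p.
  by apply: joinQ_le => q Sq; case: (noq q) => // /negP; rewrite -leNgt.
by rewrite leNgt pS.
Qed.

Variables (T : {i01 R} -> {i01 R} -> {i01 R}) (hT : left_continuous_tnorm T).

Lemma tnorm_leM p p' q q' : p <= p' -> q <= q' -> T p q <= T p' q'.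
Proof. exact: (tnorm_le hT). Qed.

Lemma tnorm_ler p q : T p q <= q.
Proof. by rewrite -[leRHS](tnorm1q hT); apply: tnorm_leM (le1Q _) (lexx _). Qed.

Lemma tnorm_lel p q : T p q <= p.
Proof. by rewrite (tnormC hT) tnorm_ler. Qed.

Lemma tnorm_joinl_le (S : set {i01 R}) q r :
  (forall p, S p -> T p q <= r) -> T (joinQ S) q <= r.
Proof.
move=> Sr; rewrite (tnormC hT); apply/(residuumP hT); apply: joinQ_le => p Sp.
by apply/(residuumP hT); rewrite (tnormC hT); exact: Sr.
Qed.

Lemma tnorm_lt1_le q r : (forall t, t < 1%:i01 -> T t q <= r) -> q <= r.
Proof.
move=> qr; rewrite -[q](tnormq1 hT); apply/(residuumP hT).
apply: le_of_lt_le => t t1; apply/(residuumP hT).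
by rewrite (tnormC hT); exact: qr.
Qed.

(** Left continuity at the unit: multiplying [q] by a factor below [1] that is
close enough to [1] does not bring it below [p]. *)
Lemma exists_tnorm_ge p q : p < q -> exists2 t, t < 1%:i01 & p <= T t q.
Proof.
move=> pq; apply: contrapT => /forall2NP not.
have : q <= p.
  apply: tnorm_lt1_le => t t1.
  by case: (not t) => // /negP; rewrite -ltNge => /ltW.
by rewrite leNgt pq.
Qed.

Lemma residuum_lt1 p r : (residuum T p r < 1%:i01) = (r < p).
Proof.
rewrite !ltNge; congr (~~ _); apply/idP/idP => [/(residuumP hT)|pr].
  by rewrite (tnormq1 hT).
by apply/(residuumP hT); rewrite (tnormq1 hT).
Qed.

Lemma residuum1q r : residuum T 1%:i01 r = r.
Proof.
apply: le_anti; apply/andP; split; last first.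
  by apply/(residuumP hT); rewrite (tnorm1q hT).
by rewrite -[leLHS](tnorm1q hT); apply/(residuumP hT).
Qed.

End UnitInterval.

(** * Fuzzy lower sets and their inclusion degrees *)

Section FuzzyLowerSets.
Variables (R : realType) (T : {i01 R} -> {i01 R} -> {i01 R}).
Hypothesis hT : left_continuous_tnorm T.
Variables (A : Type) (dA : A -> A -> {i01 R}).
Hypothesis hA : Q_order T dA.
Implicit Types (phi psi : A -> {i01 R}) (p q r s t : {i01 R}).

Lemma le_subAP phi psi s :
  s <= subA T phi psi <-> forall a, T (phi a) s <= psi a.
Proof.
split=> [s_le a|Ts]; last first.
  by apply: meetQ_ge => _ [a _ <-]; apply/(residuumP hT); exact: Ts.
apply/(residuumP hT); apply: le_trans s_le _.
by apply: meetQ_lb; exists a.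
Qed.

Lemma le_subA phi psi psi' :
  (forall a, psi a <= psi' a) -> subA T phi psi <= subA T phi psi'.
Proof.
move=> psi_le; apply/le_subAP => a; apply: le_trans (psi_le a).
by move: a; apply/le_subAP.
Qed.

(** On a chain, failing to be [1] is witnessed by a strict inequality at a
point; this is what makes irreducibility usable pointwise. *)
Lemma subA_lt1P phi psi :
  subA T phi psi < 1%:i01 <-> exists a, psi a < phi a.
Proof.
split=> [sub1|[a psi_phi]].
  apply: contrapT => /forallNP no; move: sub1; rewrite ltNge => /negP; apply.
  apply/le_subAP => a; rewrite (tnormq1 hT) leNgt.
  by apply/negP; exact: no.
rewrite ltNge; apply/negP => /le_subAP/(_ a).
by rewrite (tnormq1 hT) leNgt psi_phi.
Qed.

Lemma fuzzy_lower_set_cst r : fuzzy_lower_set T dA (fun=> r).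
Proof. by move=> x y; exact: tnorm_lel. Qed.

Lemma fuzzy_lower_set_max phi psi : fuzzy_lower_set T dA phi ->
  fuzzy_lower_set T dA psi -> fuzzy_lower_set T dA (phi \max psi).
Proof.
move=> lphi lpsi x y /=; rewrite le_max.
by case: (leP (phi y) (psi y)) => _; rewrite ?lphi ?lpsi ?orbT.
Qed.

Lemma fuzzy_lower_set_residuum a p :
  fuzzy_lower_set T dA (fun x => residuum T (dA a x) p).
Proof.
move=> x y; apply: (residuumP hT _ _ _).1.
rewrite (tnormC hT (residuum _ _ _)) (tnormA hT) (tnormC hT (dA a x)).
apply: le_trans (tnorm_leM hT (Q_order_trans hA a x y) (lexx _)) _.
exact/(residuumP hT).
Qed.

(** * Forward Cauchy ideals are irreducible *)

Section Cauchy.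
Variables (I : Type) (le : I -> I -> Prop) (x : I -> A).
Hypothesis le_dir : directed le.

Definition tail_meet i :=
  meetQ [set dA (x jk.1) (x jk.2) | jk in [set jk | le i jk.1 /\ le jk.1 jk.2]].

Definition net_ideal a :=
  joinQ (range (fun i => meetQ [set dA a (x j) | j in [set j | le i j]])).

Lemma tail_meet_le_net_ideal i j : le i j -> tail_meet i <= net_ideal (x j).
Proof.
move=> ij; have le_j : tail_meet i <=
    meetQ [set dA (x j) (x k) | k in [set k | le j k]].
  by apply: meetQ_ge => _ [k jk <-]; apply: meetQ_lb; exists (j, k).
by apply: le_trans le_j _; apply: joinQ_ub; exists j.
Qed.

Lemma net_ideal_inhabited :
  forward_cauchy dA le x -> fuzzy_inhabited net_ideal.
Proof.
move=> cx; apply: le_anti; rewrite le1Q /= -[leLHS]cx.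
apply: joinQ_le => _ [i _ <-].
apply: le_trans (tail_meet_le_net_ideal (directed_refl le_dir i)) _.
by apply: joinQ_ub; exists (x i).
Qed.

Lemma cofinal_le_subA psi s : fuzzy_lower_set T dA psi ->
  (forall i, exists2 j, le i j & s <= psi (x j)) -> s <= subA T net_ideal psi.
Proof.
move=> lpsi cof; apply/le_subAP => a.
apply: (tnorm_joinl_le hT) => _ [i _ <-].
have [j ij s_le] := cof i; apply: le_trans (lpsi a (x j)).
rewrite (tnormC hT); apply: (tnorm_leM hT) s_le _.
by apply: meetQ_lb; exists j.
Qed.

(** The two-colour pigeonhole principle for directed sets. *)
Lemma directed_cofinal_or (P1 P2 : I -> Prop) i0 :
  (forall j, le i0 j -> P1 j \/ P2 j) ->
  (forall i, exists2 j, le i j & P1 j) \/ (forall i, exists2 j, le i j & P2 j).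
Proof.
move=> P12.
have [|/existsNP[i1 /forall2NP no1]] :=
  pselect (forall i, exists2 j, le i j & P1 j); [by left|right => i].
have [k [i0k i1k]] := directed_ub le_dir i0 i1.
have [l [kl il]] := directed_ub le_dir k i.
have [i0l i1l] := (directed_trans le_dir i0k kl, directed_trans le_dir i1k kl).
exists l => //; case: (P12 l i0l) => // P1l.
by case: (no1 l).
Qed.

Lemma net_ideal_irreducible : fuzzy_lower_set T dA net_ideal ->
  forward_cauchy dA le x -> irreducible_ideal T dA net_ideal.
Proof.
move=> lnet cx; split=> // [|phi1 phi2 l1 l2]; first exact: net_ideal_inhabited.
apply: le_anti; apply/andP; split; last first.
  by rewrite ge_max !le_subA// => a /=; rewrite le_max lexx ?orbT.
set s := subA T net_ideal (phi1 \max phi2).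
have s_le : forall a, T (net_ideal a) s <= (phi1 \max phi2) a by apply/le_subAP.
rewrite -[leLHS](tnorm1q hT) -cx; apply: (tnorm_joinl_le hT) => _ [i _ <-].
rewrite -/(tail_meet i) le_max.
have : forall j, le i j ->
    T (tail_meet i) s <= phi1 (x j) \/ T (tail_meet i) s <= phi2 (x j).
  move=> j ij; apply/orP; rewrite -le_max; apply: le_trans (s_le (x j)).
  exact: tnorm_leM (tail_meet_le_net_ideal ij) (lexx _).
by move=> /directed_cofinal_or[]/cofinal_le_subA ->//; rewrite orbT.
Qed.

End Cauchy.

(** * Irreducible ideals are forward Cauchy *)

Section Irreducible.
Variable phi : A -> {i01 R}.
Hypothesis phi_irr : irreducible_ideal T dA phi.

Lemma irreducible_not_le_max phi1 phi2 :
  fuzzy_lower_set T dA phi1 -> fuzzy_lower_set T dA phi2 ->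
  (exists a, phi1 a < phi a) -> (exists a, phi2 a < phi a) ->
  exists a, (phi1 \max phi2) a < phi a.
Proof.
move=> l1 l2 /subA_lt1P lt1 /subA_lt1P lt2; apply/subA_lt1P.
by have [_ _ ->//] := phi_irr; rewrite gt_max lt1.
Qed.

Lemma inhabited_gt r : r < 1%:i01 -> exists a, r < phi a.
Proof.
have [_ <- _] := phi_irr.
by move=> /lt_joinQ[_ [a _ <-]]; exists a.
Qed.

(** [residuum T (dA a x) p < 1] says [p < dA a x], so the upper-bound condition
on [x] becomes a failure of [phi] to lie below a maximum of three lower sets,
each of which fails to contain [phi] for its own reason. *)
Lemma irreducible_common_ub a b p q r :
  p < phi a -> q < phi b -> r < 1%:i01 ->
  exists x, [/\ r < phi x, p < dA a x & q < dA b x].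
Proof.
have residuum_at c s : s < phi c -> exists x, residuum T (dA c x) s < phi x.
  by exists c; rewrite (Q_order_refl hA) residuum1q.
move=> /residuum_at pa /residuum_at qb /inhabited_gt r1.
have [la lb] := (fuzzy_lower_set_residuum a p, fuzzy_lower_set_residuum b q).
have pqab := irreducible_not_le_max la lb pa qb.
have [x] := irreducible_not_le_max (fuzzy_lower_set_max la lb)
  (fuzzy_lower_set_cst r) pqab r1.
rewrite /= !gt_max => /andP[/andP[ax bx] rx]; exists x; split=> //.
  by rewrite -(residuum_lt1 hT) (lt_le_trans ax)// le1Q.
by rewrite -(residuum_lt1 hT) (lt_le_trans bx)// le1Q.
Qed.

Definition ball := {xr : A * {i01 R} | xr.2 < phi xr.1}.
Definition center (u : ball) : A := (sval u).1.
Definition level (u : ball) : {i01 R} := (sval u).2.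

(** The formal ball order with radii read upside down, [1] being radius zero.
Requiring [level u <= dA (center u) (center v)] alone would not be transitive. *)
Definition ball_le (u v : ball) :=
  level u <= T (level v) (dA (center u) (center v)).

Lemma ball_le_dA u v : ball_le u v -> level u <= dA (center u) (center v).
Proof. by move=> uv; apply: le_trans uv (tnorm_ler hT _ _). Qed.

Lemma ball_le_level u v : ball_le u v -> level u <= level v.
Proof. by move=> uv; apply: le_trans uv (tnorm_lel hT _ _). Qed.

Lemma ball_le_refl u : ball_le u u.
Proof. by rewrite /ball_le (Q_order_refl hA) (tnormq1 hT). Qed.

Lemma ball_le_trans u v w : ball_le u v -> ball_le v w -> ball_le u w.
Proof.
move=> uv vw; apply: le_trans uv _.
apply: le_trans (tnorm_leM hT vw (lexx _)) _.
rewrite -(tnormA hT); apply: (tnorm_leM hT) => //.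
exact: (Q_order_trans hA).
Qed.

Lemma ball_ub u v : exists w, ball_le u w /\ ball_le v w.
Proof.
case: u v => [[a p] /= pa] [[b q] /= qb].
have [p' pp' p'a] := i01_dense pa; have [q' qq' q'b] := i01_dense qb.
have [t1 t11 pt1] := exists_tnorm_ge hT pp'.
have [t2 t21 qt2] := exists_tnorm_ge hT qq'.
have tmax1 : Order.max t1 t2 < 1%:i01 by rewrite gt_max t11.
have [x [tx p'x q'x]] := irreducible_common_ub p'a q'b tmax1.
exists (exist _ (x, Order.max t1 t2) tx); rewrite /ball_le /level /center /=.
split; [apply: le_trans pt1 _|apply: le_trans qt2 _];
  by apply: (tnorm_leM hT); [rewrite le_max lexx ?orbT|exact: ltW].
Qed.

Lemma ball_directed : directed ball_le.
Proof.
split; [|exact: ball_le_refl|exact: ball_le_trans|exact: ball_ub].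
have [a pa] : exists a, 0%:i01 < phi a.
  by apply: inhabited_gt; rewrite lt_def le1Q andbT -val_eqE /= oner_neq0.
exact: (inhabits (exist _ (a, 0%:i01) pa)).
Qed.

Lemma ball_forward_cauchy : forward_cauchy dA ball_le center.
Proof.
apply: le_anti; rewrite le1Q /=; apply: le_of_lt_le => r r1.
have [a ra] := inhabited_gt r1.
pose u : ball := exist _ (a, r) ra.
apply: le_trans (_ : _ <= tail_meet ball_le center u) _; last first.
  by apply: joinQ_ub; exists u.
apply: meetQ_ge => _ [[v w] /= [uv vw] <-].
exact: le_trans (ball_le_level uv) (ball_le_dA vw).
Qed.

Lemma ball_net_ideal a : phi a = net_ideal ball_le center a.
Proof.
apply: le_anti; apply/andP; split.
  apply: le_of_lt_le => r ra; pose u : ball := exist _ (a, r) ra.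
  apply: le_trans (_ : _ <=
      meetQ [set dA a (center v) | v in [set v | ball_le u v]]) _; last first.
    by apply: joinQ_ub; exists u.
  by apply: meetQ_ge => _ [v uv <-]; exact: (ball_le_dA uv).
apply: joinQ_le => _ [u _ <-]; apply: (tnorm_lt1_le hT) => t t1.
have [b tb] := inhabited_gt t1.
(* The ball [v] lies above [u] and its level is at least [t]. *)
have [v [uv bv]] := ball_ub u (exist _ (b, t) tb).
have [lphi _ _] := phi_irr; apply: le_trans (lphi a (center v)).
apply: (tnorm_leM hT); last by apply: meetQ_lb; exists v.
exact: le_trans (ball_le_level bv) (ltW (svalP v)).
Qed.

Lemma irreducible_forward_cauchy : forward_cauchy_ideal T dA phi.
Proof.
split; first by case: phi_irr.
exists ball, ball_le, center; split.
- exact: ball_directed.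
- exact: ball_forward_cauchy.
- exact: ball_net_ideal.
Qed.

End Irreducible.

End FuzzyLowerSets.

Theorem theorem3p13 (R : realType) (T : {i01 R} -> {i01 R} -> {i01 R})
    (hT : left_continuous_tnorm T)
    (A : Type) (dA : A -> A -> {i01 R}) (hA : Q_order T dA)
    (phi : A -> {i01 R}) (hphi : fuzzy_lower_set T dA phi) :
  irreducible_ideal T dA phi <-> forward_cauchy_ideal T dA phi.
Proof.
split=> [|[_ [I [le [x [le_dir cx phiE]]]]]].
  exact: irreducible_forward_cauchy.
have {}phiE : phi = net_ideal dA le x by apply/funext.
by subst phi; exact: net_ideal_irreducible.
Qed.
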